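(* For any integers $k \geq 0$ and $n \geq 1$, $$NT_{n,\mu}(q)|_{q^k} = \sum_{s=\left\lfloor\frac{3+\sqrt{1+8k}}{2}\right\rfloor}^{2k+1} c_s \binom{n-1}{s-1},$$ where $c_s = NTI_{s,\mu}(q)|_{q^k}$.
   Context: For $n\ge 1$ let $\mathcal{C}_n$ be the set of $n$-cycles in the symmetric group $S_n$ (cyclic arrangements of $\{1,\dots,n\}$). An $n$-cycle is written $C=(c_0,c_1,\dots,c_{n-1})$ with $c_0=1$, and is traversed from left to right cyclically. We say $c_s$ is cyclically between $c_i$ and $c_j$ if $i<s<j$, or $j<i<s$, or $s<j<i$. For $a<b$ in $\{1,\dots,n\}$, the pair $\langle a,b\rangle$ is an occurrence of $\mu$ (a $\mu$-match) in $C$ if there is no $x$ with $a<x<b$ that is cyclically between $a$ and $b$ in $C$; it is nontrivial if $a+1<b$. $NT_\mu(C)$ denotes the number of nontrivial $\mu$-matches in $C$. An $n$-cycle $C$ is incontractible if there is no $i$ such that $i+1$ immediately follows $i$ in $C$; $\mathcal{IC}_n$ is the set of incontractible $n$-cycles in $\mathcal{C}_n$ (the unique $1$-cycle is incontractible). Define $NT_{n,\mu}(q)=\sum_{C\in\mathcal{C}_n} q^{NT_\mu(C)}$ and $NTI_{n,\mu}(q)=\sum_{C\in\mathcal{IC}_n} q^{NT_\mu(C)}$. The notation $f(q)|_{q^k}$ means the coefficient of $q^k$ in the polynomial $f(q)$. Binomial coefficients $\binom{m}{j}$ are $0$ when $j>m$.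
   Formalization: For k = 0 the stated lower limit is 2, exceeding the upper limit 1, so the sum is empty although the coefficient is 1 (e.g. n = 1); the formal statement starts the sum at s = 1 when k = 0 and keeps the stated limits for all k ≥ 1. *)

(* Defs.v *)
From mathcomp Require Import all_boot all_order all_fingroup all_algebra.

Set Implicit Arguments.
Unset Strict Implicit.
Unset Printing Implicit Defensive.

Local Open Scope ring_scope.

(* The labels {1, ..., m + 1} are represented by 'I_m.+1 = {0, ..., m}, i.e.
   every label is shifted down by one; all the notions below only depend on
   the order and on the successor relation of the labels. *)

Definition is_ncycle m (C : 'S_m.+1) : bool := #|porbits C| == 1%N.

(* The arrangement (c_0, ..., c_m) with c_0 the least label and
   c_(i+1) = C c_i. *)
Definition cycle_word m (C : 'S_m.+1) : seq 'I_m.+1 := traject C ord0 m.+1.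

Definition position m (C : 'S_m.+1) (x : 'I_m.+1) : nat :=
  index x (cycle_word C).

Definition cyc_between m (C : 'S_m.+1) (a b x : 'I_m.+1) : bool :=
  let i := position C a in
  let j := position C b in
  let s := position C x in
  [|| (i < s < j)%N, (j < i < s)%N | (s < j < i)%N].

Definition mu_match m (C : 'S_m.+1) (a b : 'I_m.+1) : bool :=
  (a < b)%N && ~~ [exists x : 'I_m.+1, (a < x < b)%N && cyc_between C a b x].

Definition NT_mu m (C : 'S_m.+1) : nat :=
  #|[set p : 'I_m.+1 * 'I_m.+1 | mu_match C p.1 p.2 & (p.1 + 1 < p.2)%N]|.

Definition incontractible m (C : 'S_m.+1) : bool :=
  ~~ [exists i : 'I_m.+1, C i == i.+1 :> nat].

Definition ncycles m : {set 'S_m.+1} := [set C | is_ncycle C].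

Definition incontractible_ncycles m : {set 'S_m.+1} :=
  [set C in ncycles m | incontractible C].

(* The generating polynomials are indexed by the size n >= 1 of the label set;
   the value at n = 0 is junk. *)
Definition NT_poly (n : nat) : {poly int} :=
  if n is m.+1 then \sum_(C in ncycles m) 'X^(NT_mu C) else 0.

Definition NTI_poly (n : nat) : {poly int} :=
  if n is m.+1 then \sum_(C in incontractible_ncycles m) 'X^(NT_mu C) else 0.

(* Main.v *)
(* Call [i] a contraction of the cycle [C] when [C i = i + 1]. Merging [i] and
   [i + 1] at a contraction yields a cycle on one label fewer, with one
   contraction fewer and the same number of nontrivial matches, and every label
   of the smaller cycle can be split back. Counting pairs (cycle, contraction)
   gives (j + 1) N(m + 1, j + 1) = (m + 1) N(m, j) for the number N(m, j) of
   cycles on m + 1 labels with j contractions and k nontrivial matches, hence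
   N(m, j) = binom(m, j) N(m - j, 0). An incontractible cycle on s labels has at
   most binom(s - 1, 2) nontrivial matches, and at least (s - 1) / 2, because
   each pair i, i + 1 provides a nontrivial match that starts at i or ends at
   i + 1. These two bounds give the range of summation. *)
Require Import Defs.
From mathcomp Require Import all_boot all_order all_fingroup all_algebra.
From mathcomp Require Import zify lra.

Set Implicit Arguments.
Unset Strict Implicit.
Unset Printing Implicit Defensive.

Import Order.TTheory GRing.Theory Num.Theory.

(** * Cycles as a single orbit, and positions along the cycle word *)

Lemma is_ncycleP m (C : 'S_m.+1) :
  reflect (forall x, x \in porbit C ord0) (is_ncycle C).
Proof.
apply: (iffP eqP) => [C1 x | allC].
  have /eqP/cards1P[A defA] := C1.
  have : porbit C x \in porbits C by apply: imset_f.
  have : porbit C ord0 \in porbits C by apply: imset_f.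
  rewrite defA !inE => /eqP-> /eqP<-; exact: porbit_id.
suff -> : porbits C = [set porbit C ord0] by rewrite cards1.
apply/setP=> A; rewrite inE; apply/imsetP/eqP => [[x _ ->] | ->].
  by apply/esym/eqP; rewrite eq_porbit_mem porbit_sym.
by exists ord0.
Qed.

Lemma card_porbit_ncycle m (C : 'S_m.+1) :
  is_ncycle C -> #|porbit C ord0| = m.+1.
Proof.
move=> /is_ncycleP allC; rewrite -[RHS](card_ord m.+1) -cardsT.
by congr #|pred_of_set _|; apply/setP=> x; rewrite in_setT allC.
Qed.

Lemma cycle_word_uniq m (C : 'S_m.+1) : is_ncycle C -> uniq (cycle_word C).
Proof.
by move=> cC; have := uniq_traject_porbit C ord0; rewrite card_porbit_ncycle.
Qed.

Lemma mem_cycle_word m (C : 'S_m.+1) x : is_ncycle C -> x \in cycle_word C.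
Proof.
move=> cC; have /is_ncycleP/(_ x) := cC.
by rewrite porbit_traject card_porbit_ncycle.
Qed.

Lemma position_lt m (C : 'S_m.+1) x : is_ncycle C -> position C x < m.+1.
Proof.
move=> cC; have := mem_cycle_word x cC.
by rewrite -index_mem /cycle_word size_traject.
Qed.

Lemma iter_position m (C : 'S_m.+1) x :
  is_ncycle C -> iter (position C x) C ord0 = x.
Proof.
move=> cC; rewrite -(nth_traject C (position_lt x cC)).
exact: nth_index (mem_cycle_word x cC).
Qed.

Lemma position_iter m (C : 'S_m.+1) t :
  is_ncycle C -> t < m.+1 -> position C (iter t C ord0) = t.
Proof.
move=> cC lt_t; rewrite -(nth_traject C lt_t) /position index_uniq //.
  by rewrite size_traject.
exact: cycle_word_uniq.
Qed.

Lemma position_eq m (C : 'S_m.+1) x y :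
  is_ncycle C -> (position C x == position C y) = (x == y).
Proof.
move=> cC; apply/eqP/eqP => [eq_xy | -> //].
by rewrite -(iter_position x cC) eq_xy iter_position.
Qed.

Lemma is_ncycle_iterP m (C : 'S_m.+1) :
  reflect (forall x, exists t, x = iter t C ord0) (is_ncycle C).
Proof.
apply: (iffP (is_ncycleP C)) => allC x.
  by have /porbitP[t ->] := allC x; exists t; rewrite permX.
by have [t ->] := allC x; rewrite -permX mem_porbit.
Qed.

(* The points [x] given by [unliftP] have the type ['I_n.+1.-1], which [lia]
   does not identify with ['I_n]. *)
Lemma lift_cases n (h y : 'I_n.+1) : (exists x : 'I_n, y = lift h x) \/ y = h.
Proof. by case: (unliftP h y) => [x -> | ->]; [left; exists x | right]. Qed.

(** * Splitting a label into two consecutive ones *)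

Definition contractions m (C : 'S_m.+1) : {set 'I_m.+1} :=
  [set i | C i == i.+1 :> nat].

(** Products apply the left factor first: [lift_perm] adds i + 1 as a fixed point, and the
    transposition in front of it inserts this label right after i. *)
Definition expand m (i : 'I_m.+1) (C : 'S_m.+1) : 'S_m.+2 :=
  (tperm (widen_ord (leqnSn _) i) (lift ord0 i)
     * lift_perm (lift ord0 i) (lift ord0 i) C)%g.

Section Expand.
Variables (m : nat) (i : 'I_m.+1).
Implicit Type C : 'S_m.+1.

Let i0 : 'I_m.+2 := widen_ord (leqnSn _) i.
Let i1 : 'I_m.+2 := lift ord0 i.

Lemma val_lift_widen (x : 'I_m.+1) : lift i0 x = x + (i <= x) :> nat.
Proof. by rewrite /= addnC. Qed.

Lemma val_lift_succ (x : 'I_m.+1) : lift i1 x = x + (i < x) :> nat.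
Proof. by rewrite /= addnC. Qed.

Lemma val_widen : i0 = i :> nat. Proof. by []. Qed.

Lemma val_succ : i1 = i.+1 :> nat. Proof. by []. Qed.

Let lift_valE := (val_lift_widen, val_lift_succ, val_widen, val_succ).

Lemma lift_succ : lift i1 i = i0.
Proof. by apply: val_inj; rewrite /= /bump /=; lia. Qed.

Lemma lift_widen : lift i0 i = i1.
Proof. by apply: val_inj; rewrite /= /bump /=; lia. Qed.

Lemma expand_widen C : expand i C i0 = i1.
Proof. by rewrite permM tpermL lift_perm_id. Qed.

Lemma expand_succ C : expand i C i1 = lift i1 (C i).
Proof. by rewrite permM tpermR -/i0 -lift_succ lift_perm_lift. Qed.

Lemma expand_lift C x : x != i -> expand i C (lift i1 x) = lift i1 (C x).
Proof.
move=> ne_xi; rewrite permM tpermD ?lift_perm_lift //; last exact: neq_lift.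
by rewrite -/i0 -lift_succ (inj_eq lift_inj) eq_sym.
Qed.

Lemma expand_inj : injective (expand i).
Proof.
move=> C C' /mulgI eqC; apply/permP=> x; apply: (@lift_inj _ i1).
by rewrite -!(lift_perm_lift i1 i1) eqC.
Qed.

Lemma expand_surj (D : 'S_m.+2) : D i0 = i1 -> exists C, D = expand i C.
Proof.
move=> Di0.
(* [E] is [D] with [i1] cut out of its cycle and fixed, so it restricts to a permutation of the
   other labels. *)
pose E : 'S_m.+2 := (tperm i0 i1 * D)%g.
have Ei1 : E i1 = i1 by rewrite permM tpermR.
pose f x := odflt x (unlift i1 (E (lift i1 x))).
have fE x : lift i1 (f x) = E (lift i1 x).
  rewrite /f; case: unliftP => [y -> // | ].
  by rewrite -{2}Ei1 => /perm_inj/eqP; rewrite eq_sym (negPf (neq_lift _ _)).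
have f_inj : injective f.
  move=> x y eqf; apply: (@lift_inj _ i1); apply: (@perm_inj _ E).
  by rewrite -!fE eqf.
exists (perm f_inj); apply: (@mulgI _ (tperm i0 i1)); apply/permP=> y.
rewrite -[LHS]/(E y) /expand mulgA tperm2 mul1g.
case: (unliftP i1 y) => [x -> | ->]; last by rewrite lift_perm_id.
by rewrite lift_perm_lift (permE f_inj) fE.
Qed.

(** Once the walk has left [i], the detour through [i1] costs one extra step. *)
Lemma iter_expand C t : is_ncycle C -> t < m.+1 ->
  iter (t + (position C i < t)) (expand i C) ord0 = lift i1 (iter t C ord0).
Proof.
move=> cC; elim: t => [_ | t IHt lt_t].
  by rewrite ltn0; apply: val_inj; rewrite /= /bump /=.
have pt : position C (iter t C ord0) = t by apply: position_iter; last lia.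
have [it | ne_it] := eqVneq (iter t C ord0) i.
  have pi : position C i = t by rewrite -it.
  move: (IHt ltac:(lia)); rewrite pi ltnn addn0 ltnSn addn1 /= => ->.
  by rewrite it lift_succ expand_widen expand_succ.
have ne_pt : position C i != t by rewrite -pt position_eq // eq_sym.
have -> : t.+1 + (position C i < t.+1) = (t + (position C i < t)).+1 by lia.
by rewrite /= IHt ?expand_lift //; lia.
Qed.

Lemma is_ncycle_expand C : is_ncycle (expand i C) = is_ncycle C.
Proof.
apply/idP/idP => cC.
  (* The walk along the expanded permutation projects to the walk along [C], which waits at [i]
     while the former visits [i1]. *)
  have orb t : exists s, iter t (expand i C) ord0 = lift i1 (iter s C ord0) \/
      iter t (expand i C) ord0 = i1 /\ iter s C ord0 = i.
    elim: t => [|t [s [IHt|[IHt IHs]]]] /=.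
    - by exists 0; left; apply: val_inj; rewrite /= /bump.
    - rewrite IHt; have [sE|ne_s] := eqVneq (iter s C ord0) i.
        by exists s; right; rewrite sE lift_succ expand_widen.
      by exists s.+1; left; rewrite expand_lift.
    - by exists s.+1; left; rewrite IHt expand_succ /= IHs.
  apply/is_ncycle_iterP=> x.
  have [t tE] := is_ncycle_iterP _ cC (lift i1 x).
  have [s [sE|[sE _]]] := orb t; exists s.
    by apply: (@lift_inj _ i1); rewrite tE.
  by move: (neq_lift i1 x); rewrite tE sE eqxx.
have orb x : exists t, lift i1 x = iter t (expand i C) ord0.
  by rewrite -{1}(iter_position x cC) -iter_expand ?position_lt //; eexists.
apply/is_ncycle_iterP=> y; case: (unliftP i1 y) => [x -> // | ->].
have [t tE] := orb i; exists t.+1.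
by rewrite /= -tE lift_succ expand_widen.
Qed.

Section Positions.
Variable C : 'S_m.+1.
Hypothesis cC : is_ncycle C.

Lemma position_expand_lift x :
  position (expand i C) (lift i1 x)
    = position C x + (position C i < position C x).
Proof.
rewrite -{1}(iter_position x cC) -iter_expand ?position_lt //.
by rewrite position_iter ?is_ncycle_expand //; have := position_lt x cC; lia.
Qed.

Lemma position_expand_succ : position (expand i C) i1 = (position C i).+1.
Proof.
have cE : is_ncycle (expand i C) by rewrite is_ncycle_expand.
have := position_expand_lift i; rewrite ltnn addn0 lift_succ => pE.
rewrite -(expand_widen C) -{1}(iter_position i0 cE) pE -iterS.
by rewrite position_iter //; have := position_lt i cC.
Qed.

Lemma position_expand_lift_widen x :
  position (expand i C) (lift i0 x)
    = position C x + (position C i <= position C x).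
Proof.
have [-> | ne_xi] := eqVneq x i.
  by rewrite lift_widen position_expand_succ leqnn addn1.
have -> : lift i0 x = lift i1 x.
  by apply: val_inj; move: ne_xi; rewrite -val_eqE /= /bump /=; lia.
rewrite position_expand_lift; have := position_eq x i cC.
by rewrite (negPf ne_xi); lia.
Qed.

Lemma cyc_between_expand a b x :
    x != a -> x != b -> a != b ->
  cyc_between (expand i C) (lift i0 a) (lift i1 b) (lift i1 x)
    = cyc_between C a b x.
Proof.
rewrite -!(position_eq _ _ cC) /cyc_between !position_expand_lift.
by rewrite position_expand_lift_widen; lia.
Qed.

Lemma cyc_between_expand_succ a b :
    i != a -> i != b -> a != b ->
  cyc_between (expand i C) (lift i0 a) (lift i1 b) i1 = cyc_between C a b i.
Proof.
rewrite -!(position_eq _ _ cC) /cyc_between !position_expand_lift.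
by rewrite position_expand_lift_widen position_expand_succ; lia.
Qed.

(** [lift i0] sends [i] to its upper copy [i1], and [lift i1] sends it to its lower copy [i0]. Hence
    the labels strictly between the two lifts are exactly the copies of those strictly between [a]
    and [b], and the insertion preserves the cyclic order. *)
Lemma mu_match_expand (a b : 'I_m.+1) : a < b ->
  mu_match (expand i C) (lift i0 a) (lift i1 b) = mu_match C a b.
Proof.
move=> lt_ab; have ne_ab : a != b by rewrite -val_eqE /=; lia.
have lt_ab' : lift i0 a < lift i1 b by move: lt_ab; rewrite !lift_valE; lia.
rewrite /mu_match lt_ab lt_ab'; congr (~~ _).
apply/existsP/existsP => [[y] | [x]] /andP[/andP[lt_ay lt_yb] btw].
  case: (lift_cases i1 y) => [[x yE] | yE]; rewrite {}yE in lt_ay lt_yb btw.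
    have {}lt_ay : a < x by move: lt_ay; rewrite !lift_valE; lia.
    have {}lt_yb : x < b by move: lt_yb; rewrite !lift_valE; lia.
    exists x; rewrite lt_ay lt_yb -cyc_between_expand -?val_eqE //=; lia.
  have {}lt_ay : a < i by move: lt_ay; rewrite !lift_valE; lia.
  have {}lt_yb : i < b by move: lt_yb; rewrite !lift_valE; lia.
  exists i; rewrite lt_ay lt_yb -cyc_between_expand_succ -?val_eqE //=; lia.
exists (lift i1 x); rewrite cyc_between_expand //; last 2 first.
- by rewrite -val_eqE /=; lia.
- by rewrite -val_eqE /=; lia.
by rewrite btw andbT !lift_valE; lia.
Qed.

(* No nontrivial match of the expanded cycle starts at [i0] or ends at [i1],
   because these two labels are adjacent in it. *)
Lemma NT_mu_expand : NT_mu (expand i C) = NT_mu C.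
Proof.
pose f (p : 'I_m.+1 * 'I_m.+1) := (lift i0 p.1, lift i1 p.2).
have f_inj : injective f.
  by move=> [a b] [a' b'] /pair_equal_spec[/lift_inj/= -> /lift_inj/= ->].
rewrite /NT_mu -(card_imset _ f_inj); congr #|pred_of_set _|.
have pi0 : position (expand i C) i0 = position C i.
  by rewrite -lift_succ position_expand_lift ltnn addn0.
have cE : is_ncycle (expand i C) by rewrite is_ncycle_expand.
have adj y : y != i0 -> y != i1 ->
    cyc_between (expand i C) i0 y i1 && cyc_between (expand i C) y i1 i0.
  rewrite -!(position_eq _ _ cE) /cyc_between pi0 position_expand_succ; lia.
apply/setP=> -[a b]; rewrite inE /=.
apply/andP/imsetP => [[mab ltab] | [[a' b']]].
  have /andP[_ /existsPn nbtw] := mab.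
  case: (lift_cases i0 a) => [[a' aE] | aE]; last first.
    have bi0 : b != i0.
      by apply: contraTneq ltab => ->; rewrite aE !lift_valE; lia.
    have bi1 : b != i1.
      by apply: contraTneq ltab => ->; rewrite aE !lift_valE; lia.
    have /andP[btw _] := adj b bi0 bi1.
    by move: (nbtw i1) ltab; rewrite aE btw !lift_valE; lia.
  case: (lift_cases i1 b) => [[b' bE] | bE]; last first.
    have ai0 : a != i0.
      by apply: contraTneq ltab => ->; rewrite bE !lift_valE; lia.
    have ai1 : a != i1.
      by apply: contraTneq ltab => ->; rewrite bE !lift_valE; lia.
    have /andP[_ btw] := adj a ai0 ai1.
    by move: (nbtw i0) ltab; rewrite bE btw !lift_valE; lia.
  exists (a', b'); last by rewrite /f aE bE.
  move: mab ltab; rewrite aE bE inE !lift_valE /= => mab.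
  (* Splitting widens the gap only if a' < i < b', and then a' + 2 <= b' already, so nontriviality
     passes to the smaller cycle. *)
  have [ltab | geab] := ltnP a' b'.
    rewrite -mu_match_expand // mab; lia.
  by lia.
rewrite inE /= => /andP[mab ltab] [-> ->].
by rewrite mu_match_expand ?mab ?lift_valE; first split; lia.
Qed.

End Positions.

(** The new contraction is [i0]. An old one at [i] moves to the upper copy [i1], which inherits the
    image of [i]; the others are merely relabelled. *)
Lemma card_contractions_expand C :
  #|contractions (expand i C)| = #|contractions C|.+1.
Proof.
have -> : contractions (expand i C) = i0 |: lift i0 @: contractions C.
  apply/setP=> y; rewrite !inE.
  case: (lift_cases i0 y) => [[x ->] | ->]; last first.
    by rewrite expand_widen !lift_valE !eqxx.
  rewrite [_ == i0]eq_sym (negPf (neq_lift _ _)) (mem_imset _ _ lift_inj) inE orFb.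
  have [-> | ne_xi] := eqVneq x i.
    by rewrite lift_widen expand_succ !lift_valE; lia.
  have -> : lift i0 x = lift i1 x.
    by apply: val_inj; move: ne_xi; rewrite -val_eqE /= /bump /=; lia.
  rewrite expand_lift // !lift_valE; move: ne_xi; rewrite -val_eqE /=; lia.
rewrite cardsU1 (card_imset _ lift_inj); case: imsetP => [[x _ /eqP]|] //=.
by rewrite (negPf (neq_lift _ _)).
Qed.

End Expand.

(** * Counting cycles by their contractions *)

Lemma card_contractions m (C : 'S_m.+2) :
  #|contractions C|
    = \sum_(i < m.+1) (C (widen_ord (leqnSn _) i) == lift ord0 i).
Proof.
rewrite -sum1_card big_mkcond big_ord_recr /=.
(* The greatest label is never a contraction: its successor is out of range. *)
rewrite inE ltn_eqF ?addn0 //; apply: eq_bigr => i _.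
by rewrite inE -val_eqE /=; case: eqP.
Qed.

Lemma card_contractions_le m (C : 'S_m.+1) : #|contractions C| <= m.
Proof.
case: m C => [|m] C.
  by rewrite leqn0 cards_eq0; apply/eqP/setP=> i; rewrite !inE !ord1.
rewrite card_contractions -[leqRHS]card_ord -sum1_card.
by apply: leq_sum => i _; case: eqP.
Qed.

Definition cycles_with m k j : {set 'S_m.+1} :=
  [set C in ncycles m | (NT_mu C == k) && (#|contractions C| == j)].

Lemma expand_cycles_with m k j (i : 'I_m.+1) :
  [set C in cycles_with m.+1 k j.+1
     | C (widen_ord (leqnSn _) i) == lift ord0 i]
    = expand i @: cycles_with m k j.
Proof.
apply/setP=> D; rewrite !inE; apply/andP/imsetP => [[] | [C]].
  move=> DP /eqP/expand_surj[C DE]; exists C => //; move: DP.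
  rewrite DE !inE is_ncycle_expand card_contractions_expand eqSS.
  by case/and3P=> cC; rewrite NT_mu_expand ?cC // => -> ->.
rewrite !inE => /and3P[cC NTC KC] ->.
rewrite expand_widen is_ncycle_expand cC NT_mu_expand // NTC.
by rewrite card_contractions_expand eqSS KC.
Qed.

(* Double counting of the pairs of a cycle and one of its contractions. *)
Lemma card_cycles_with_step m k j :
  j.+1 * #|cycles_with m.+1 k j.+1| = m.+1 * #|cycles_with m k j|.
Proof.
transitivity (\sum_(C in cycles_with m.+1 k j.+1) #|contractions C|).
  rewrite mulnC -sum_nat_const; apply: eq_bigr => C.
  by rewrite !inE => /and3P[_ _ /eqP->].
under eq_bigr => C _ do rewrite card_contractions.
transitivity (\sum_(i < m.+1) #|cycles_with m k j|); last first.
  by rewrite sum_nat_const card_ord.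
rewrite exchange_big /=.
apply: eq_bigr => i _; rewrite -(card_imset _ (@expand_inj _ i)).
rewrite -expand_cycles_with -sum1_card big_mkcond [RHS]big_mkcond /=.
by apply: eq_bigr => C _; rewrite [in RHS]inE; case: (_ \in _); case: eqP.
Qed.

Lemma card_cycles_with m k j : j <= m ->
  #|cycles_with m k j| = #|cycles_with (m - j) k 0| * 'C(m, j).
Proof.
elim: j m => [|j IHj] m; first by rewrite subn0 bin0 muln1.
case: m => // m lt_jm; apply/eqP; rewrite -(eqn_pmul2l (ltn0Sn j)); apply/eqP.
by rewrite card_cycles_with_step IHj // subSS [RHS]mulnCA -mul_bin_diag mulnCA.
Qed.

(** * Bounds on the number of nontrivial matches *)

Lemma incontractibleE m (C : 'S_m.+1) :
  incontractible C = (#|contractions C| == 0).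
Proof.
rewrite /incontractible -[RHS]negbK -lt0n; congr (~~ _).
by apply/existsP/card_gt0P => -[i Ci]; exists i; rewrite ?inE // in Ci *.
Qed.

(** A nontrivial match ending at [b] starts at one of the [b.-1] labels below [b.-1]. *)
Lemma NT_mu_le m (C : 'S_m.+1) : NT_mu C <= 'C(m, 2).
Proof.
have -> : 'C(m, 2) = \sum_(b < m.+1) b.-1.
  by rewrite big_ord_recl add0n -bin2_sum big_mkord.
have -> : NT_mu C = \sum_(b < m.+1) \sum_(a < m.+1)
                      (mu_match C a b && (a + 1 < b)).
  rewrite exchange_big pair_bigA /= /NT_mu -sum1_card big_mkcond /=.
  by apply: eq_bigr => p _; rewrite inE; case: ifP.
apply: leq_sum => b _; rewrite -[leqRHS]card_ord -sum1_card.
rewrite (big_ord_widen m.+1 (fun=> 1)); last by have := ltn_ord b; lia.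
rewrite [leqRHS]big_mkcond; apply: leq_sum => a _.
by case: ifP; lia.
Qed.

Lemma position_perm m (C : 'S_m.+1) x : is_ncycle C ->
  position C (C x) = if position C x < m then (position C x).+1 else 0.
Proof.
move=> cC; have lt_x := position_lt x cC; case: ifP => [ltm | gem].
  by rewrite -{1}(iter_position x cC) -iterS position_iter.
(* If the image of the last label had position p + 1, injectivity would put that last label at
   position p < m. *)
case pCx: (position C (C x)) => [//|p].
have := iter_position (C x) cC; rewrite pCx /= => /perm_inj px.
have := position_lt (C x) cC; rewrite pCx => lt_p.
by have := position_iter cC (ltnW lt_p); rewrite px; lia.
Qed.

(* If the arc from [i] to [i + 1] has labels above [i + 1], the least of them
   ends a match starting at [i]; otherwise the greatest label of the arc starts
   a match ending at [i + 1]. *)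
Lemma mu_match_succ_pair m (C : 'S_m.+1) (i j : 'I_m.+1) :
    is_ncycle C -> incontractible C -> j = i.+1 :> nat ->
  exists2 p : 'I_m.+1 * 'I_m.+1, mu_match C p.1 p.2 && (p.1 + 1 < p.2)
    & p.1 = i \/ p.2 = j.
Proof.
move=> cC /existsPn incC jE.
pose S x := cyc_between C i j x.
have neS x : S x -> (x != i) && (x != j).
  by rewrite -!(position_eq _ _ cC) /S /cyc_between; lia.
(* Incontractibility makes the open arc from [i] to [j] nonempty: it contains [C i]. *)
have SCi : S (C i).
  have : C i != j by have := incC i; rewrite -val_eqE /= jE.
  have : j != i by rewrite -val_eqE /=; lia.
  rewrite -!(position_eq _ _ cC) /S /cyc_between position_perm //.
  by have := position_lt i cC; have := position_lt j cC; case: ifP; lia.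
have [/existsP[x Px] | nogt] := boolP [exists x, S x && (j < x)].
  have [z /andP[Sz gt_z] zmin] :=
    arg_minnP (P := fun x => S x && (j < x)) (@nat_of_ord _) Px.
  exists (i, z); last by left.
  rewrite /= /mu_match; apply/andP; split; last by lia.
  apply/andP; split; first by lia.
  apply/existsPn => y; apply/negP => /andP[/andP[lt_iy lt_yz] btw].
  (* A label [y] between [i] and [z] in value and on the arc differs from [j] = i + 1, so it exceeds
     [j] and contradicts the minimality of [z]. *)
  have Sy : S y by move: btw Sz; rewrite /S /cyc_between; lia.
  have /andP[_] := neS y Sy; rewrite -val_eqE /= => ne_yj.
  by have := zmin y; rewrite Sy; lia.
have ltS x : S x -> x < i.
  move=> Sx; have /existsPn/(_ x) := nogt; rewrite Sx /=.
  by have := neS x Sx; rewrite -!val_eqE /=; lia.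
have [z Sz zmax] := arg_maxnP (P := S) (@nat_of_ord _) SCi.
have lt_z := ltS z Sz.
exists (z, j); last by right.
rewrite /= /mu_match; apply/andP; split; last by lia.
apply/andP; split; first by lia.
apply/existsPn => y; apply/negP => /andP[/andP[lt_zy lt_yj] btw].
have Sy : S y by move: btw Sz; rewrite /S /cyc_between; lia.
by have := zmax y Sy; lia.
Qed.

Lemma incontractible_le_NT_mu m (C : 'S_m.+1) :
  is_ncycle C -> incontractible C -> m <= 2 * NT_mu C.
Proof.
move=> cC incC; rewrite /NT_mu; set T := finset _.
(* [f1] recovers i from a match starting at i, [f2] from a match ending at i + 1; together their
   images contain the m labels below the greatest. *)
pose f1 (p : 'I_m.+1 * 'I_m.+1) := p.1.
pose f2 (p : 'I_m.+1 * 'I_m.+1) : 'I_m.+1 := inord p.2.-1.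
have sub : [set~ ord_max] \subset f1 @: T :|: f2 @: T.
  apply/subsetP=> i; rewrite !inE -val_eqE /= => ne_im.
  have jP : i.+1 < m.+1 by have := ltn_ord i; lia.
  have [p pT pij] :=
    mu_match_succ_pair cC incC (erefl : Ordinal jP = i.+1 :> nat).
  apply/orP; case: pij => [p1 | p2]; [left | right]; apply/imsetP.
    by exists p; rewrite ?inE.
  by exists p; rewrite ?inE // /f2 p2 /= inord_val.
have := subset_leq_card sub; rewrite cardsC1 card_ord /= => /leq_trans-> //.
rewrite (leq_trans (leq_card_setU _ _)) // mul2n -addnn.
by rewrite leq_add ?leq_imset_card.
Qed.

(** * Coefficients and the range of summation *)

Local Open Scope ring_scope.

Lemma coef_sum_Xn m (A : {set 'S_m.+1}) k :
  (\sum_(C in A) 'X^(NT_mu C) : {poly int})`_k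
    = (#|[set C in A | NT_mu C == k]|)%:R.
Proof.
rewrite coef_sum -sum1_card natr_sum big_mkcond [RHS]big_mkcond /=.
by apply: eq_bigr => C _; rewrite coefXn inE eq_sym; case: (C \in A); case: eqP.
Qed.

Lemma coef_NTI_poly m k : (NTI_poly m.+1)`_k = (#|cycles_with m k 0|)%:R.
Proof.
rewrite coef_sum_Xn; congr (_%:R); apply: eq_card => C.
by rewrite !inE incontractibleE -andbA; case: is_ncycle; rewrite //= andbC.
Qed.

Lemma coef_NT_poly m k :
  (NT_poly m.+1)`_k = \sum_(1 <= s < m.+2) (NTI_poly s)`_k * ('C(m, s.-1))%:R.
Proof.
rewrite coef_sum_Xn big_add1 /= big_mkord.
under eq_bigr => s _ do rewrite coef_NTI_poly -natrM.
rewrite -natr_sum; congr (_%:R).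
(* Cycles with j contractions contribute the term s = m + 1 - j, hence the reversal of the index. *)
rewrite (reindex_inj rev_ord_inj) /= -sum1_card.
rewrite (partition_big (fun C => inord #|contractions C| : 'I_m.+1) xpredT) //=.
apply: eq_bigr => j _; rewrite subSS; have lt_j := ltn_ord j.
rewrite bin_sub // -card_cycles_with // -sum1_card.
apply: eq_bigl => C; rewrite !inE -andbA; congr (_ && (_ && _)).
by rewrite -val_eqE /= inordK // ltnS card_contractions_le.
Qed.

Lemma coef_NTI_eq0_low k s : (0 < s)%N -> ('C(s.-1, 2) < k)%N ->
  (NTI_poly s)`_k = 0.
Proof.
case: s => // m _ ltk; rewrite coef_NTI_poly (_ : cycles_with m k 0 = set0).
  by rewrite cards0.
apply/setP=> C; rewrite !inE; apply/negP=> /and3P[_ /eqP NTk _].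
by have := NT_mu_le C; rewrite NTk leqNgt ltk.
Qed.

Lemma coef_NTI_eq0_high k s : (2 * k + 1 < s)%N -> (NTI_poly s)`_k = 0.
Proof.
case: s => // m ltk; rewrite coef_NTI_poly (_ : cycles_with m k 0 = set0).
  by rewrite cards0.
apply/setP=> C; rewrite !inE; apply/negP=> /and3P[cC /eqP NTk].
rewrite -incontractibleE => /(incontractible_le_NT_mu cC); lia.
Qed.

(** The ranges to be compared, 1 to n and the one of the theorem, need not contain one another; both
    sums equal the sum up to a common bound. *)
Lemma sum_nat_support (V : nmodType) (F : nat -> V) a b c d :
    (forall s, ~~ (a <= s < b)%N -> F s = 0) ->
    (forall s, ~~ (c <= s < d)%N -> F s = 0) ->
  \sum_(a <= s < b) F s = \sum_(c <= s < d) F s.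
Proof.
suff toM a' b' M : (b' <= M)%N -> (forall s, ~~ (a' <= s < b')%N -> F s = 0) ->
    \sum_(a' <= s < b') F s = \sum_(0 <= s < M) F s.
  by move=> Fab Fcd; rewrite !(@toM _ _ (maxn b d)) ?leq_maxl ?leq_maxr.
move=> le_bM F0; rewrite (big_nat_widen _ _ _ _ _ le_bM) (big_nat_widenl _ 0) //.
rewrite big_mkcond; apply: eq_bigr => s _.
by case: ifP => // /negbT ns; rewrite F0 //; move: ns; rewrite andbC.
Qed.

(** The number under the floor is the larger root of (s - 1)(s - 2) = 2k. *)
Lemma bin2_lt_floor (R : archiRcfType) (k s : nat) : (0 < k)%N -> (0 < s)%N ->
    (s < absz (Num.floor ((3 + Num.sqrt (1 + 8 * k%:R)) / 2 : R)))%N ->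
  ('C(s.-1, 2) < k)%N.
Proof.
move=> k_gt0; case: s => // m _; set r := Num.sqrt _; set x : R := (_ / 2).
move=> lt_s; have r_ge0 : 0 <= r by apply: sqrtr_ge0.
have le_sx : m.+2%:R <= x.
  have : m.+2%:Z <= Num.floor x.
    by rewrite -(gez0_abs (_ : 0 <= Num.floor x)) ?floor_ge0 ?lez_nat // /x; lra.
  by rewrite Num.Theory.floor_ge_int.
have r2 : r * r = 1 + 8 * k%:R by rewrite -expr2 sqr_sqrtr // addr_ge0 ?mulr_ge0.
rewrite ltnNge; apply/negP => /= lek.
have le_k : (2 * k + m <= m * m)%N.
  by have := mul_bin_diag m 1; rewrite bin1; case: m {lt_s le_sx} lek; nia.
have {}le_k : 2 * k%:R + m%:R <= m%:R * m%:R :> R.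
  by rewrite -!natrM -natrD ler_nat.
have k1 : 1 <= k%:R :> R by rewrite ler1n.
have m0 : 0 <= m%:R :> R by [].
have le_mr : 2 * m%:R + 1 <= r by move: le_sx; rewrite /x -(natr1 m.+1) -natr1; lra.
(* Squaring gives m^2 + m <= 2k, while [le_k] gives 2k <= m^2 - m; so m = 0 and k = 0, against
   [k1]. *)
have := ler_pM (_ : 0 <= 2 * m%:R + 1) _ le_mr le_mr; rewrite r2; nra.
Qed.

(* For k = 0 the floor formula gives the lower limit 2, which would omit the
   term s = 1 and make the sum empty; the sum starts at s = 1 in that case. *)
Theorem theorem4 (R : archiRcfType) (k n : nat) (hn : (1 <= n)%N) :
  (NT_poly n)`_k =
  \sum_((if k == 0%N then 1%N
         else absz (Num.floor ((3 + Num.sqrt (1 + 8 * k%:R)) / 2 : R)))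
        <= s < (2 * k + 1).+1)
     (NTI_poly s)`_k * ('C(n - 1, s - 1))%:R.
Proof.
case: n hn => // m _; rewrite coef_NT_poly !subn1 /=.
under [RHS]eq_bigr => s _ do rewrite subn1.
apply: sum_nat_support => s.
  (* At s = 0 the truncated [s.-1] makes the binomial 1, and the term vanishes because [NTI_poly 0]
     is 0. *)
  case: s => [|s] s_out; first by rewrite coef0 mul0r.
  by rewrite bin_small ?mulr0 //=; lia.
case: s => [|s]; first by rewrite coef0 mul0r.
have [lt_s _ | le_s] := ltnP (2 * k + 1) s.+1.
  by rewrite coef_NTI_eq0_high ?mul0r.
move: le_s; case: (posnP k) => [-> | k_gt0] le_s; first by rewrite /=; lia.
move=> s_out; rewrite coef_NTI_eq0_low ?mul0r //.
by apply: (@bin2_lt_floor R) => //; move: s_out => /=; lia.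
Qed.
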